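(* Let $X$ be a non-degenerate real-valued random variable with probability distribution $\mu$, and let $G:(0,1)\to(-\infty,\infty)$ be $G(t)=\inf\{u\in\mathbb{R}: \mu((-\infty,u])\ge t\}$. Then, for each $p\in(0,1)$, $X$ admits a decomposition of the form $$X \ \stackrel{\mathcal D}{=}\ Y_p(t)+\delta_p^-(t)\,\eta ,$$ where: (1) $\eta$ and $t$ are independent random variables, with $\eta$ a binary variable taking the values $\{0,1\}$ with probabilities $\{1-p,p\}$, correspondingly, and $t$ having the uniform distribution in $(0,1)$; (2) $Y_p:(0,1)\to(-\infty,\infty)$ is the monotone non-decreasing function $Y_p(t):=G((1-p)t)$; (3') $\delta_p^-:(0,1)\to[0,\infty)$ is the non-increasing function $\delta_p^-(t):=G(1-pt)-G((1-p)t)$; (4') for any $x_-<x_+$ and $p_\pm>0$ such that $$\mathbb{P}(X\le x_-)\ge p_-\quad\text{and}\quad \mathbb{P}(X>x_+)>p_+ ,$$ at the particular value $p=\frac{p_+}{p_-+p_+}$ we have $$\mathbb{P}_t\big(\{\delta_p^-(t)>x_+-x_-\}\big)\ \ge\ p_-+p_+ ,$$ where the probability is with respect to the uniform random variable $t$ in $(0,1)$.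
   Context: A real random variable is non-degenerate if its distribution is not concentrated at a single point. $\stackrel{\mathcal D}{=}$ denotes equality of probability distributions. *)

(* Defs.v *)
From mathcomp Require Import all_boot all_order all_algebra.
From mathcomp Require Import all_classical all_reals all_analysis.

Set Implicit Arguments.
Unset Strict Implicit.
Unset Printing Implicit Defensive.
Import Order.TTheory GRing.Theory Num.Theory.
Import numFieldNormedType.Exports.

Local Open Scope classical_set_scope.
Local Open Scope ring_scope.

Definition nondegenerate_law (R : realType) (mu : set R -> \bar R) : Prop :=
  ~ exists c : R, mu [set c] = 1%E.

Definition same_law (R : realType) (mu nu : set R -> \bar R) : Prop :=
  forall A : set R, measurable A -> mu A = nu A.

Definition independent_rv (d : measure_display) (T : measurableType d)
    (R : realType) (P : probability T R) (X Y : {RV P >-> R}) : Prop :=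
  forall A B : set R, measurable A -> measurable B ->
    P (X @^-1` A `&` Y @^-1` B) = (P (X @^-1` A) * P (Y @^-1` B))%E.

Definition is_binary_rv (d : measure_display) (T : measurableType d)
    (R : realType) (P : probability T R) (p : R) (X : {RV P >-> R}) : Prop :=
  [/\ forall w, X w = 0 \/ X w = 1,
      P [set w | X w = 0] = (1 - p)%:E &
      P [set w | X w = 1] = p%:E].

(* The values are required to lie in the open interval everywhere, and not only
   almost surely, so that functions given on ]0, 1[ can be composed with X. *)
Definition is_uniform01_rv (d : measure_display) (T : measurableType d)
    (R : realType) (P : probability T R) (X : {RV P >-> R}) : Prop :=
  (forall w, 0 < X w < 1) /\
  same_law (distribution P X) (uniform_prob (@ltr01 R)).

(* Meaningful for 0 < t < 1: see quantile_has_inf. *)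
Definition quantile (R : realType) (mu : set R -> \bar R) (t : R) : R :=
  inf [set u : R | (t%:E <= mu `]-oo, u]%classic)%E].

Lemma quantile_has_inf (d : measure_display) (T : measurableType d)
    (R : realType) (P : probability T R) (X : {RV P >-> R}) (t : R) :
  0 < t < 1 ->
  has_inf [set u : R | (t%:E <= distribution P X `]-oo, u]%classic)%E].
Proof.
move=> /andP[t0 t1]; split.
  have [M [_ hM]] : \forall u \near +oo, (t%:E < cdf X u)%E.
    apply: (@cvg_cdfy1 _ _ _ P X [set y | t%:E < y]%E).
    apply: open_nbhs_nbhs; split; first exact: open_ereal_gt_ereal.
    by rewrite /= lte_fin.
  by exists (M + 1) => /=; apply/ltW/hM; rewrite ltrDl.
have [M [_ hM]] : \forall u \near -oo, (cdf X u < t%:E)%E.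
  apply: (@cvg_cdfNy0 _ _ _ P X [set y | y < t%:E]%E).
  apply: open_nbhs_nbhs; split; first exact: open_ereal_lt_ereal.
  by rewrite /= lte_fin.
exists M => u /= hu; rewrite leNgt; apply/negP => /hM.
by rewrite ltNge hu.
Qed.

Definition Yfun (R : realType) (mu : set R -> \bar R) (p t : R) : R :=
  quantile mu ((1 - p) * t).

Definition delta_minus (R : realType) (mu : set R -> \bar R) (p t : R) : R :=
  quantile mu (1 - p * t) - quantile mu ((1 - p) * t).

(* Main.v *)
(** On the product of the uniform law on ]0, 1[ and the Bernoulli law of
    parameter p, the sum equals G((1-p)t) when eta = 0 and G(1-pt) when eta = 1.
    Since G(s) <= x iff s <= F(x), where F is the distribution function of X, the
    event that the sum is at most x is the disjoint union of the rectangles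
    {t <= F(x)/(1-p), eta = 0} and {t >= (1-F(x))/p, eta = 1}, whose
    probabilities min(F(x), 1-p) and max(0, F(x)-(1-p)) add up to F(x).
    For p = p_+/(p_- + p_+) and t <= p_- + p_+ one has (1-p)t <= p_- <= F(x_-)
    and 1-pt >= 1-p_+ > F(x_+), so G((1-p)t) <= x_- and G(1-pt) > x_+. *)

From HB Require Import structures.
Require Import Defs.
From mathcomp Require Import all_boot all_order all_algebra.
From mathcomp Require Import all_classical all_reals all_analysis.
From mathcomp Require Import measurable_realfun lra.
Import Order.TTheory GRing.Theory Num.Theory.
Import numFieldNormedType.Exports.
Local Open Scope classical_set_scope.
Local Open Scope ring_scope.

(** * Distribution functions and quantiles *)

(** The half-open intervals are closed under intersection, generate the Borel sets and cover the
    line by bounded pieces. On each of them a probability is a difference of two values of its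
    distribution function. *)
Lemma measure_unique_cdf (R : realType) (P Q : probability R R) :
  (forall x, P `]-oo, x]%classic = Q `]-oo, x]%classic) ->
  forall A, measurable A -> P A = Q A.
Proof.
move=> PQ A mA.
pose g (k : nat) : set R := `](- k%:R), k%:R]%classic.
apply: (@measure_unique _ R R (@ocitv R) g) => //.
- exact: ocitvI.
- by move=> k; exact: is_ocitv.
- rewrite -subTset => x _ /=.
  exists (Num.truncn `|x|).+1 => //; rewrite /g /= in_itv /=.
  by have := truncnS_gt `|x|; rewrite ltr_norml => /andP[-> /ltW ->].
- move=> _ [[a b] _ <-] /=.
  have [ab|ba] := leP a b; last by rewrite set_itv_ge ?measure0// bnd_simp -leNgt ltW.
  have -> : `]a, b]%classic = `]-oo, b] `\` `]-oo, a].
    by rewrite -[RHS]setCK setCD setCitvl setUC -[LHS]setCK setCitv.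
  rewrite !measureD ?setIidr//; try exact: subset_itvl.
  + by congr (_ - _)%E; exact: PQ.
  + by rewrite -ge0_fin_numE// fin_num_measure.
  + by rewrite -ge0_fin_numE// fin_num_measure.
- by move=> k; rewrite -ge0_fin_numE// fin_num_measure//; exact: measurable_itv.
Qed.

(** From right to left, an infimum is a lower bound. From left to right, right continuity is
    essential: if [t] exceeds the distribution function at [x], it still does so at some [y > x],
    yet the infimum yields [u < y] at which the level [t] is reached. *)
Lemma quantile_le (R : realType) (d : measure_display) (T : measurableType d)
    (P : probability T R) (X : {RV P >-> R}) (t x : R) : 0 < t < 1 ->
  (quantile (distribution P X) t <= x) =
  (t%:E <= distribution P X `]-oo, x]%classic)%E.
Proof.
move=> t01; have [ne lb] := quantile_has_inf X t01.
apply/idP/idP => [qx|tF]; last by apply: ge_inf.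
have rc := @cdf_right_continuous _ _ _ P X x.
rewrite leNgt; apply/negP => Ft.
have Flt : \forall y \near x^'+, (cdf X y < t%:E)%E.
  apply: (rc [set z | z < t%:E]%E); apply: open_nbhs_nbhs.
  by split; first exact: open_ereal_lt_ereal.
have [y [Fy xy]] : exists y, (cdf X y < t%:E)%E /\ x < y.
  apply: (@filter_ex _ x^'+); exact: filterI Flt (nbhs_right_gt x).
have [u /= tu uy] := inf_lt ne (le_lt_trans qx xy).
have /(le_trans tu) : (distribution P X `]-oo, u]%classic <= cdf X y)%E.
  exact/cdf_nondecreasing/ltW.
by move=> /le_lt_trans/(_ Fy); rewrite ltxx.
Qed.

Lemma quantile_homo (R : realType) (d : measure_display) (T : measurableType d)
    (P : probability T R) (X : {RV P >-> R}) (s t : R) :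
  0 < s -> s <= t -> t < 1 ->
  quantile (distribution P X) s <= quantile (distribution P X) t.
Proof.
move=> s0 st t1; rewrite quantile_le ?s0 ?(le_lt_trans st)//.
apply: (@le_trans _ _ t%:E); first by rewrite lee_fin.
by rewrite -quantile_le// t1 (lt_le_trans s0 st).
Qed.

(** * The uniform law on the unit interval *)

Section uniform.
Context {R : realType}.
Local Notation U := (uniform_prob (@ltr01 R)).

Lemma uniform_prob01E (A : set R) : measurable A ->
  U A = lebesgue_measure (A `&` `[0, 1]%classic).
Proof.
move=> mA; rewrite /uniform_prob integral_uniform_pdf.
rewrite (eq_integral (cst 1%E)) ?integral_cst ?mul1e//; first exact: measurableI.
move=> x; rewrite inE => -[_ /=]; rewrite in_itv/= => x01.
by rewrite /uniform_pdf x01 subr0 invr1.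
Qed.

Lemma uniform_prob01_itvNyc (c : R) : 0 <= c ->
  U `]-oo, c]%classic = (Num.min c 1)%:E.
Proof.
move=> c0; rewrite uniform_prob01E//.
rewrite (_ : _ `&` _ = `[0, Num.min c 1]%classic).
  rewrite lebesgue_measure_itv/= lte_fin -EFinB subr0 lt_min ltr01 andbT.
  case: ltP => // c0'; have -> : c = 0 by apply: le_anti; rewrite c0'.
  by rewrite min_l.
apply/seteqP; split => x /=; rewrite !in_itv/= le_min.
  by move=> [-> /andP[-> ->]].
by move=> /and3P[-> -> ->].
Qed.

Lemma uniform_prob01_itvcy (c : R) : 0 <= c ->
  U `[c, +oo[%classic = (Num.max (1 - c) 0)%:E.
Proof.
move=> c0; rewrite uniform_prob01E//.
rewrite (_ : _ `&` _ = `[c, 1]%classic).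
  rewrite lebesgue_measure_itv/= lte_fin -EFinB.
  by case: (ltP c) => c1; [rewrite max_l|rewrite max_r] => //; lra.
apply/seteqP; split => x /=; rewrite !in_itv/= andbT.
  by move=> [-> /andP[_ ->]].
by move=> /andP[cx ->]; rewrite cx (le_trans c0 cx).
Qed.

(** Inside the closed unit interval, only the two endpoints can be lost, and they form a Lebesgue
    null set. *)
Lemma uniform_prob01_setIoo (A : set R) : measurable A ->
  U (A `&` `]0, 1[%classic) = U A.
Proof.
move=> mA; pose I := `]0, 1[%classic : set R.
have mI : measurable I by exact: measurable_itv.
rewrite [RHS](_ : _ = U (A `\` I) + U (A `&` I))%E; last exact: measureDI.
rewrite (_ : U (A `\` _) = 0%E) ?add0e//.
rewrite uniform_prob01E; last exact: measurableD.
apply/eqP; rewrite -measure_le0.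
apply: (@le_trans _ _ (lebesgue_measure [set 0; 1 : R])).
  apply: le_measure; rewrite ?inE//.
  - by apply: measurableI => //; exact: measurableD.
  - exact: measurableU.
  - move=> x [[_ xI]] /=; rewrite in_itv/= => /andP[x0 x1].
    have [->|xn0] := eqVneq x 0; first by left.
    have [->|xn1] := eqVneq x 1; first by right.
    by exfalso; apply: xI; rewrite /I/= in_itv/= !lt_neqAle eq_sym xn0 xn1 x0.
rewrite countable_lebesgue_measure0//.
exact/finite_set_countable/finite_set2.
Qed.

(* The uniform variable must lie in ]0, 1[ surely, whereas [uniform_prob] only
   gives it almost surely. *)
Definition clip01 (x : measurableTypeR R) : R := if 0 < x < 1 then x else 2^-1.

Lemma clip01_itv x : 0 < clip01 x < 1.
Proof. by rewrite /clip01; case: ifP => // _; lra. Qed.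

Lemma measurable_clip01 : measurable_fun setT clip01.
Proof.
apply: measurable_fun_ifT => //.
by apply: measurable_and; exact: measurable_fun_ltr.
Qed.

(** On the open unit interval, which carries all the mass, [clip01] is the identity. *)
Lemma uniform_prob_clip01 (A : set R) : measurable A ->
  U (clip01 @^-1` A) = U A.
Proof.
move=> mA; rewrite -[LHS]uniform_prob01_setIoo; last first.
  by rewrite -[X in measurable X]setTI; exact: measurable_clip01.
rewrite -[RHS]uniform_prob01_setIoo//; congr (U _).
by apply/seteqP; split => x [] /= + x01; move: (x01);
  rewrite in_itv/= => x01'; rewrite /clip01 x01'.
Qed.

End uniform.

(** * The coupling on the product space *)

Section quantile_coupling.
Context {R : realType} {d : measure_display} {T : measurableType d}.
Context (P : probability T R) (X : {RV P >-> R}) (p : R) (p01 : 0 < p < 1).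

Local Notation U := (uniform_prob (@ltr01 R)).
Local Notation mu := (distribution P X).
Local Notation Omega := (measurableTypeR R * bool)%type.

Lemma onemM_itv01 t : 0 < t < 1 -> 0 < (1 - p) * t < 1.
Proof.
move=> /andP[t0 t1]; have [p0 p1] := andP p01.
by rewrite mulr_gt0 ?subr_gt0//= mulr_ilt1//; lra.
Qed.

Lemma onem_mul_itv01 t : 0 < t < 1 -> 0 < 1 - p * t < 1.
Proof.
move=> /andP[t0 t1]; have [p0 p1] := andP p01.
by rewrite subr_gt0 gtrBl mulr_gt0// mulr_ilt1//; lra.
Qed.

Definition coupling_prob : probability Omega R := (U \x bernoulli_prob p)%E.

Definition coupling_unif (w : Omega) : R := clip01 w.1.
Definition coupling_bin (w : Omega) : R := w.2%:R.
Definition coupling_sum (w : Omega) : R :=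
  Yfun mu p (coupling_unif w) + delta_minus mu p (coupling_unif w) * coupling_bin w.

Lemma measurable_coupling_unif : measurable_fun setT coupling_unif.
Proof. exact: (measurableT_comp measurable_clip01). Qed.

Lemma measurable_coupling_bin : measurable_fun setT coupling_bin.
Proof. exact: (@measurableT_comp _ _ _ _ _ _ (fun b : bool => b%:R : R)). Qed.

HB.instance Definition _ :=
  isMeasurableFun.Build _ _ _ _ coupling_unif measurable_coupling_unif.
HB.instance Definition _ :=
  isMeasurableFun.Build _ _ _ _ coupling_bin measurable_coupling_bin.

Lemma measurable_coupling_rect (A : set R) (B : set bool) : measurable A ->
  measurable [set w : Omega | A (coupling_unif w) /\ B w.2].
Proof.
move=> mA.
have -> : [set w : Omega | A (coupling_unif w) /\ B w.2] = (clip01 @^-1` A) `*` B.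
  by [].
apply: measurableX => //.
by rewrite -[X in measurable X]setTI; exact: measurable_clip01.
Qed.

(** The common source of the law of the sum, of both marginals and of independence: clipping leaves
    [U] unchanged, so this is the product formula for rectangles. *)
Lemma coupling_rect (A : set R) (B : set bool) : measurable A ->
  coupling_prob [set w | A (coupling_unif w) /\ B w.2] =
  (U A * bernoulli_prob p B)%E.
Proof.
move=> mA; rewrite -uniform_prob_clip01// -product_measure1E//.
by rewrite -[X in measurable X]setTI; exact: measurable_clip01.
Qed.

(** Once the coin is fixed, the sum is a single quantile and [quantile_le] makes the event a linear
    condition on [t]. This gives both the measurability of the sum and its law. *)
Lemma coupling_sum_le x :
  let F := fine (mu `]-oo, x]%classic) in
  coupling_sum @^-1` `]-oo, x]%classic =
    [set w | `]-oo, F / (1 - p)]%classic (coupling_unif w) /\ [set false] w.2] `|`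
    [set w | `[(1 - F) / p, +oo[%classic (coupling_unif w) /\ [set true] w.2].
Proof.
move=> F; have muF : mu `]-oo, x]%classic = F%:E by rewrite fineK// fin_num_measure.
apply/seteqP; split => -[u b] /=; rewrite !in_itv/= andbT;
 rewrite /coupling_sum /Yfun /delta_minus /coupling_bin /=;
 have := clip01_itv u; rewrite -[clip01 u]/(coupling_unif (u, b));
 move: (coupling_unif _) => t t01.
all: have [/andP[p0 p1] /andP[t0 t1]] := (p01, t01).
- case: b => /=; rewrite ?mulr0 ?mulr1 ?addr0.
    (* When the coin shows [true], the two quantiles at [(1 - p) * t] cancel. *)
    rewrite addrC subrK quantile_le ?onem_mul_itv01// muF lee_fin.
    by right; split => //; rewrite ler_pdivrMr//; lra.
  rewrite quantile_le ?onemM_itv01// muF lee_fin.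
  by left; split => //; rewrite ler_pdivlMr ?subr_gt0//; lra.
- move=> [[h ->]|[h ->]] /=; rewrite ?mulr0 ?mulr1 ?addr0; move: h.
    by rewrite quantile_le ?onemM_itv01// muF lee_fin ler_pdivlMr ?subr_gt0//; lra.
  rewrite [quantile _ _ + _]addrC subrK quantile_le ?onem_mul_itv01// muF lee_fin.
  by rewrite ler_pdivrMr//; lra.
Qed.

(** Open upper half-lines generate the Borel sets, and their preimages are complements of unions of
    two measurable rectangles. *)
Lemma measurable_coupling_sum : measurable_fun setT coupling_sum.
Proof.
apply: (measurability _ (RGenOInfty.measurableE R)) => //= _ [_ [x ->] <-].
rewrite setTI -setCitvl preimage_setC; apply: measurableC.
rewrite [X in measurable X](coupling_sum_le x).
apply: measurableU; exact: measurable_coupling_rect.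
Qed.

HB.instance Definition _ :=
  isMeasurableFun.Build _ _ _ _ coupling_sum measurable_coupling_sum.
(** The measurability of the sum rests on [p01], so the bundled variable gets a name that takes this
    hypothesis. *)
Definition coupling_sum_rv : {RV coupling_prob >-> R} := coupling_sum.

Lemma bernoulli_prob_true : bernoulli_prob p [set true] = p%:E.
Proof.
rewrite bernoulli_probE; last by have [/ltW-> /ltW->] := andP p01.
by rewrite !diracE mem_set// memNset// mule1 mule0 adde0.
Qed.

Lemma bernoulli_prob_false : bernoulli_prob p [set false] = (1 - p)%:E.
Proof.
rewrite bernoulli_probE; last by have [/ltW-> /ltW->] := andP p01.
by rewrite !diracE memNset// mem_set// mule1 mule0 add0e.
Qed.

Lemma same_law_coupling_sum : same_law mu (distribution coupling_prob coupling_sum_rv).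
Proof.
have [p0 p1] := andP p01; have q0 : 0 < 1 - p by rewrite subr_gt0.
apply: (@measure_unique_cdf _ mu (distribution coupling_prob coupling_sum_rv)) => x.
transitivity (coupling_prob (coupling_sum @^-1` `]-oo, x]%classic)); last by [].
rewrite coupling_sum_le.
set F := fine _.
have muF : mu `]-oo, x]%classic = F%:E by rewrite fineK// fin_num_measure.
have F0 : 0 <= F by rewrite -lee_fin -muF.
have F1 : F <= 1 by rewrite -lee_fin -muF probability_le1.
transitivity F%:E => //.
transitivity (U `]-oo, (F / (1 - p))%R] * bernoulli_prob p [set false] +
    U `[((1 - F) / p)%R, +oo[ * bernoulli_prob p [set true])%E; last first.
  rewrite measureU; first by congr (_ + _)%E; apply/esym; exact: coupling_rect.
  - exact: measurable_coupling_rect.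
  - exact: measurable_coupling_rect.
  (* The rectangles are disjoint because they prescribe different coin values. *)
  - by apply/seteqP; split => // -[u b] /= [[_ ->] [_]].
rewrite bernoulli_prob_true bernoulli_prob_false.
rewrite uniform_prob01_itvNyc ?divr_ge0// ?(ltW q0)//.
rewrite uniform_prob01_itvcy ?divr_ge0 ?subr_ge0 ?(ltW p0)//.
rewrite -!EFinM -EFinD; congr EFin.
(* Below [1 - p] the first rectangle has mass [F] and the second is null; above it, the first
   saturates at [1 - p] and the second supplies the remaining [F - (1 - p)]. *)
have [Fp|Fp] := leP F (1 - p).
  rewrite min_l ?ler_pdivrMr ?mul1r// max_r; last first.
    by rewrite subr_le0 ler_pdivlMr//; lra.
  by rewrite divfK ?gt_eqF// mul0r addr0.
rewrite min_r ?ler_pdivlMr ?mul1r// ?ltW// max_l; last first.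
  by rewrite subr_ge0 ler_pdivrMr//; lra.
by rewrite mulrBl divfK ?gt_eqF//; lra.
Qed.

Lemma coupling_unif_law (A : set R) : measurable A ->
  coupling_prob (coupling_unif @^-1` A) = U A.
Proof.
move=> mA; have := coupling_rect A setT mA.
rewrite probability_setT mule1 => <-; congr (coupling_prob _).
by apply/seteqP; split => // w [].
Qed.

Lemma coupling_bin_law (A : set R) :
  coupling_prob (coupling_bin @^-1` A) =
  bernoulli_prob p [set b | A b%:R].
Proof.
have := coupling_rect setT [set b | A b%:R] measurableT.
rewrite probability_setT mul1e => <-; congr (coupling_prob _).
by apply/seteqP; split => // w [].
Qed.

Lemma coupling_independent : independent_rv
  (coupling_bin : {RV coupling_prob >-> R}) (coupling_unif : {RV coupling_prob >-> R}).
Proof.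
move=> A B mA mB; rewrite coupling_bin_law coupling_unif_law// muleC.
by rewrite -coupling_rect// setIC.
Qed.

Lemma coupling_binary :
  is_binary_rv p (coupling_bin : {RV coupling_prob >-> R}).
Proof.
split.
- by case=> u []; [right|left].
- rewrite -bernoulli_prob_false -[LHS]/(coupling_prob (coupling_bin @^-1` [set 0])).
  rewrite coupling_bin_law; congr (bernoulli_prob p _).
  by apply/seteqP; split => -[] //= /eqP; rewrite oner_eq0.
- rewrite -bernoulli_prob_true -[LHS]/(coupling_prob (coupling_bin @^-1` [set 1])).
  rewrite coupling_bin_law; congr (bernoulli_prob p _).
  by apply/seteqP; split => -[] //= /eqP; rewrite eq_sym oner_eq0.
Qed.

(** The difference is that of the sum with the coin forced to [true] and to [false], so its
    measurability is inherited from [coupling_sum]. *)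
Lemma measurable_delta_coupling_unif :
  measurable_fun setT (fun w => delta_minus mu p (coupling_unif w)).
Proof.
have mb b : measurable_fun setT (fun w : Omega => coupling_sum (w.1, b)).
  by apply: (measurableT_comp measurable_coupling_sum); exact: measurable_fun_pair.
rewrite (_ : (fun _ => _) =
    (fun w => coupling_sum (w.1, true)) \- (fun w => coupling_sum (w.1, false))).
  exact: measurable_funB.
apply/funext => w /=; rewrite /coupling_sum /coupling_bin /= mulr1 mulr0 addr0.
by rewrite addrC addKr.
Qed.

End quantile_coupling.

(** * Monotonicity and the tail bound for the coupling *)

Theorem theorem2p2 (R : realType) (d : measure_display) (T : measurableType d)
    (P : probability T R) (X : {RV P >-> R})
    (hX : nondegenerate_law (distribution P X)) (p : R) (hp : 0 < p < 1) :
  let mu := distribution P X in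
  let Y := Yfun mu p in
  let delta := delta_minus mu p in
  exists (d' : measure_display) (T' : measurableType d')
    (Q : probability T' R) (t eta Z : {RV Q >-> R}),
    [/\ (forall w, Z w = Y (t w) + delta (t w) * eta w) /\
          same_law mu (distribution Q Z),
        [/\ independent_rv eta t, is_binary_rv p eta & is_uniform01_rv t],
        (forall s s', 0 < s -> s <= s' -> s' < 1 -> Y s <= Y s'),
        (forall s, 0 < s < 1 -> 0 <= delta s) /\
          (forall s s', 0 < s -> s <= s' -> s' < 1 -> delta s' <= delta s) &
        forall xm xp pm pp : R, xm < xp -> 0 < pm -> 0 < pp ->
          (pm%:E <= P [set w | (X w <= xm)%R])%E ->
          (pp%:E < P [set w | (xp < X w)%R])%E ->
          p = pp / (pm + pp) ->
          ((pm + pp)%R%:E <= Q [set w | (xp - xm < delta (t w))%R])%E].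
Proof.
move=> mu Y delta; have [p0 p1] := andP hp.
have p1' : 0 < 1 - p by rewrite subr_gt0.
have homoY s s' : 0 < s -> s <= s' -> s' < 1 -> Y s <= Y s'.
  move=> s0 ss' s1; apply: quantile_homo; rewrite ?mulr_gt0 ?ler_pM2l//.
  by have /(onemM_itv01 _ hp)/andP[] : 0 < s' < 1 by rewrite s1 (lt_le_trans s0 ss').
have homoq s s' : 0 < s -> s <= s' -> s' < 1 ->
    quantile mu (1 - p * s') <= quantile mu (1 - p * s).
  move=> s0 ss' s1; apply: quantile_homo; rewrite ?lerB ?ler_pM2l//.
    by have /(onem_mul_itv01 _ hp)/andP[] : 0 < s' < 1 by rewrite s1 (lt_le_trans s0 ss').
  by rewrite gtrBl mulr_gt0.
exists _, _, (coupling_prob p), coupling_unif, coupling_bin, (coupling_sum_rv P X p hp).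
split => //.
- by split => //; exact: same_law_coupling_sum.
- split; [exact: coupling_independent|exact: coupling_binary|].
  split => [w|A mA]; first exact: clip01_itv.
  exact: coupling_unif_law.
- split => [s s01|s s' s0 ss' s1]; last first.
    by apply: lerB; [exact: homoq|exact: homoY].
  have /andP[l0 _] := onemM_itv01 _ hp _ s01.
  have /andP[_ u1] := onem_mul_itv01 _ hp _ s01.
  (* The levels are ordered because [1 - p * s] exceeds [(1 - p) * s] by [1 - s]. *)
  by rewrite subr_ge0; apply: quantile_homo => //; lra.
move=> xm xp pm pp xmp pm0 pp0 hm hpp pE.
have sp0 : 0 < pm + pp by rewrite addr_gt0.
have muxp : (mu `]-oo, xp]%classic < (1 - pp)%:E)%E.
  move: hpp; rewrite (_ : P _ = ccdf X xp); last first.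
    by congr (P _); apply/seteqP; split => w /=; rewrite in_itv/= andbT.
  rewrite ccdf_1_cdf -[mu _]/(cdf X xp) -(@fineK _ (cdf X xp)) ?fin_num_measure//.
  by rewrite -EFinB !lte_fin; lra.
have muxm : (pm%:E <= mu `]-oo, xm]%classic)%E by [].
(* Monotonicity of the distribution function between [xm] and [xp] gives [pm < 1 - pp]. Hence the
   uniform law gives []-oo, pm + pp]] exactly the mass [pm + pp], without truncation at 1. *)
have le1 : pm + pp < 1.
  have : (pm%:E < (1 - pp)%:E)%E.
    apply: le_lt_trans muxm (le_lt_trans _ muxp).
    by apply: cdf_nondecreasing; exact: ltW.
  by rewrite lte_fin; lra.
(* With the bound read as the probability that [t] is at most [pm + pp], an inclusion of events
   suffices. *)
have <- : coupling_prob p (coupling_unif @^-1` `]-oo, pm + pp]%classic) = (pm + pp)%:E.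
  by rewrite coupling_unif_law// uniform_prob01_itvNyc ?min_l// ltW.
apply: le_measure; rewrite ?inE.
- exact: measurable_funPTI.
- rewrite -[X in measurable X]setTI.
  have := measurable_delta_coupling_unif P X p hp measurableT
    `]xp - xm, +oo[%classic (measurable_itv _).
  by rewrite set_itvoy.
move=> w /=; rewrite in_itv/= => tw.
have t01 := clip01_itv w.1; rewrite -/(coupling_unif w) in t01.
(* The upper quantile must exceed [xp] strictly, which follows by negating [quantile_le]; here
   [p * t <= pp] by the choice of [p]. The lower one need only be at most [xm]. *)
apply: ltr_leB.
  rewrite ltNge quantile_le ?onem_mul_itv01// -ltNge (lt_le_trans muxp)// lee_fin.
  by rewrite lerB// pE mulrAC ler_pdivrMr// ler_pM2l.
rewrite quantile_le ?onemM_itv01// (le_trans _ muxm)// lee_fin.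
have -> : 1 - p = pm / (pm + pp).
  by rewrite pE -[1](divff (lt0r_neq0 sp0)) -mulrBl addrK.
by rewrite mulrAC ler_pdivrMr// ler_pM2l.
Qed.
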